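(* Let $a$ be a nonzero integer and let $n$ be a positive integer with $n\ge 5$. Then $$\begin{aligned} E_{2n,a}&\equiv \frac{a}{2a-1}-96a^3n^5+(16a^5-32a^4-64a^2)n^4+(72a^7-64a^3)n^3\\&\quad-(24a^7-120a^6+92a^5-56a^3+128a)n^2\\&\quad-(80a^7-72a^6-20a^5+104a^4-6a^3+64a^2-128a)n\pmod{2^{\mathrm{ord}_2 n+8}}.\end{aligned}$$
   Context: For a real number $a$, the sequence $\{E_{n,a}\}$ is defined by $E_{0,a}=1$ and $E_{n,a}=-a\sum_{k=1}^{\lfloor n/2\rfloor}\binom{n}{2k}E_{n-2k,a}$ for $n\ge 1$. For an integer $a$, all $E_{n,a}$ are integers. For a prime $p$ and a positive integer $n$, $\mathrm{ord}_p n$ denotes the largest nonnegative integer $\alpha$ with $p^\alpha\mid n$. A congruence between rational numbers whose denominators are coprime to $p$ is understood modulo the given power of $p$ in the ring of such rationals (here $2a-1$ is odd, so $\frac{a}{2a-1}$ makes sense modulo powers of 2). *)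

(* Defs.v *)
From mathcomp Require Import all_boot all_order all_algebra.

Set Implicit Arguments.
Unset Strict Implicit.
Unset Printing Implicit Defensive.

Import Order.TTheory GRing.Theory Num.Theory.
Local Open Scope ring_scope.

(* [Eseq a n] lists E_{0,a}, ..., E_{n,a}: course-of-values recursion. The
   defining recurrences are proved below as [E_0] and [E_rec]. The parameter a
   ranges over any commutative ring, in particular over the reals. *)
Fixpoint Eseq (R : comNzRingType) (a : R) (n : nat) : seq R :=
  if n is m.+1 then
    rcons (Eseq a m)
      (- a * \sum_(1 <= k < (n./2).+1) 'C(n, 2 * k)%:R * (Eseq a m)`_(n - 2 * k))
  else [:: 1].

Definition E (R : comNzRingType) (a : R) (n : nat) : R := (Eseq a n)`_n.

Lemma size_Eseq (R : comNzRingType) (a : R) n : size (Eseq a n) = n.+1.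
Proof. by elim: n => //= n IHn; rewrite size_rcons IHn. Qed.

Lemma nth_Eseq (R : comNzRingType) (a : R) n m :
  (m <= n)%N -> (Eseq a n)`_m = E a m.
Proof.
elim: n => [|n IHn]; first by rewrite leqn0 => /eqP ->.
rewrite leq_eqVlt => /predU1P[-> //|ltmn].
by rewrite /= nth_rcons size_Eseq ltmn IHn.
Qed.

Lemma E_0 (R : comNzRingType) (a : R) : E a 0 = 1.
Proof. by []. Qed.

Lemma E_rec (R : comNzRingType) (a : R) n : (0 < n)%N ->
  E a n = - a * \sum_(1 <= k < (n./2).+1) 'C(n, 2 * k)%:R * E a (n - 2 * k).
Proof.
case: n => // n _.
rewrite {1}/E [Eseq _ _]/= nth_rcons size_Eseq ltnn eqxx; congr (_ * _).
apply: eq_big_nat => k /andP[k_gt0 _]; rewrite nth_Eseq //.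
by rewrite leq_subLR -add1n leq_add2r muln_gt0.
Qed.

(* Any two readings of E_{n,a} for an integer a (in int, rat, the reals) agree;
   in particular E_{n,a} is an integer when a is. *)
Lemma rmorph_E (R S : comNzRingType) (f : {rmorphism R -> S}) (a : R) n :
  f (E a n) = E (f a) n.
Proof.
elim/ltn_ind: n => -[|n] IHn; first by rewrite !E_0 rmorph1.
rewrite !E_rec // rmorphM rmorphN rmorph_sum; congr (_ * _).
apply: eq_big_nat => k /andP[k_gt0 _]; rewrite rmorphM rmorph_nat IHn //.
by rewrite ltn_subrL muln_gt0 k_gt0.
Qed.

Definition p_integral (p : nat) (x : rat) : bool := coprime p `|denq x|%N.

(* x = y (mod p^k) in the ring of rationals with denominator coprime to p; both
   sides are required to lie in that ring. *)
Definition congr_pow (p k : nat) (x y : rat) : Prop :=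
  [/\ p_integral p x, p_integral p y
    & exists2 z : rat, p_integral p z & x - y = p%:R ^+ k * z].

(* Main.v *)
(* The generating function of E_{n,a} is 1 / (1 - a + a cosh x). Multiplying
   numerator and denominator by (a - 1) + a cosh x turns the denominator into
   (2a - 1) + a^2 sinh^2 x, so with q = - a^2 / (2a - 1)
     1 / (1 - a + a cosh x)
       = (2a - 1)^-1 * sum_k q^k (a cosh x + (a - 1)) sinh^(2k) x.
   The coefficient of x^(2n) / (2n)! in sinh^(2k) x is divisible by
   (2k)! 4^(n-k), so these parts vanish modulo 2^(ord_2 n + 8) once n >= 5. The
   one in cosh x sinh^(2k) x is sum_j C(n, j) Y(j, k), where (2k)! 8^(j-k)
   divides Y(j, k); since j C(n, j) = n C(n-1, j-1), only the terms with
   j <= 4 survive, and they form an explicit polynomial in n. Instead of power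
   series, the dual operators cosh(d/dX) and sinh(d/dX) act on polynomials. *)
From HB Require Import structures.
Require Import Defs.
From mathcomp Require Import all_boot all_order all_algebra.
From mathcomp Require Import ring zify.

Import Order.TTheory GRing.Theory Num.Theory.
Local Open Scope ring_scope.

(** * Hyperbolic difference operators on polynomials *)

Section CentralDifference.
Variable F : numFieldType.
Implicit Types p q : {poly F}.

(* cosh(d/dX) and sinh(d/dX), the shift by 1 being exp(d/dX). *)
Definition coshD p := 2^-1 *: ((p \Po ('X + 1)) + (p \Po ('X - 1))).
Definition sinhD p := 2^-1 *: ((p \Po ('X + 1)) - (p \Po ('X - 1))).

Lemma coshD_is_linear : linear coshD.
Proof. by move=> c p q; rewrite /coshD !comp_polyD !comp_polyZ -!mul_polyC; ring. Qed.

Lemma sinhD_is_linear : linear sinhD.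
Proof. by move=> c p q; rewrite /sinhD !comp_polyD !comp_polyZ -!mul_polyC; ring. Qed.

HB.instance Definition _ :=
  GRing.isLinear.Build F {poly F} {poly F} *:%R coshD coshD_is_linear.
HB.instance Definition _ :=
  GRing.isLinear.Build F {poly F} {poly F} *:%R sinhD sinhD_is_linear.

Lemma shiftK p : (p \Po ('X + 1)) \Po ('X - 1) = p.
Proof. by rewrite -comp_polyA comp_polyD comp_polyX comp_polyC subrK comp_polyXr. Qed.

Lemma unshiftK p : (p \Po ('X - 1)) \Po ('X + 1) = p.
Proof. by rewrite -comp_polyA comp_polyB comp_polyX comp_polyC addrK comp_polyXr. Qed.

Lemma coshD_sinhD p : coshD (sinhD p) = sinhD (coshD p).
Proof.
rewrite /coshD /sinhD !comp_polyZ !comp_polyB !comp_polyD shiftK unshiftK.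
by rewrite -!mul_polyC; ring.
Qed.

Lemma coshD_coshD p : coshD (coshD p) = p + sinhD (sinhD p).
Proof.
(* [ring] does not simplify the constant 2^-1, so 1 is written as 2^-1 * 2^-1 * 4 to match the
   product of the two halves. *)
have half4 : (2^-1 * 2^-1 * 4)%:P * p = p.
  by rewrite (_ : _ * 4 = 1) ?polyC1 ?mul1r //; field.
rewrite /coshD /sinhD !comp_polyZ !comp_polyB !comp_polyD shiftK unshiftK.
by rewrite -[X in _ = X + _]half4 -!mul_polyC !polyCM; ring.
Qed.

Lemma coshD_mulX p : coshD ('X * p) = 'X * coshD p + sinhD p.
Proof.
rewrite /coshD /sinhD !comp_polyM !comp_polyX -!mul_polyC; ring.
Qed.

Lemma sinhD_mulX p : sinhD ('X * p) = 'X * sinhD p + coshD p.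
Proof.
rewrite /coshD /sinhD !comp_polyM !comp_polyX -!mul_polyC; ring.
Qed.

(** The commutator of [sinhD] with multiplication by ['X] is [coshD], which commutes with [sinhD],
    so m equal terms accumulate. At m = 0 the truncated [m.-1] is multiplied by 0. *)
Lemma iter_sinhD_mulX m p :
  iter m sinhD ('X * p) = 'X * iter m sinhD p + coshD (iter m.-1 sinhD p) *+ m.
Proof.
elim: m => [|m IHm]; first by rewrite mulr0n addr0.
rewrite iterS IHm linearD /= sinhD_mulX linearMn /= -coshD_sinhD mulrS -addrA.
by case: m {IHm} => [|m] //; rewrite !mulr0n.
Qed.

Lemma coshD_iter_sinhD m p : coshD (iter m sinhD p) = iter m sinhD (coshD p).
Proof. by elim: m => //= m IHm; rewrite coshD_sinhD IHm. Qed.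

Lemma iter_sinhD_Xn m j : (j < m)%N -> iter m sinhD 'X^j = 0.
Proof.
elim: j m => [|j IHj] [|m] // ltjm.
  rewrite expr0 iterSr -polyC1 {2}/sinhD !comp_polyC subrr scaler0.
  by elim: m {ltjm} => //= m ->; rewrite linear0.
by rewrite exprS iter_sinhD_mulX /= !IHj ?linear0 ?mulr0 ?mul0rn ?addr0 // ltnW.
Qed.

End CentralDifference.

(** * The umbral functional and its expansion in powers of q *)

(** Turns the parity filter left by the binomial theorem into the half-range sum of the recurrence
    for E. *)
Lemma big_ord_even {V : nmodType} (f : nat -> V) m :
  \sum_(i < m.+1) (if odd i then 0 else f i) = \sum_(0 <= k < (m./2).+1) f (2 * k)%N.
Proof.
elim: m => [|m IHm]; first by rewrite big_ord1 big_nat1.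
rewrite big_ord_recr /= {}IHm uphalf_half; case: ifP => /= [/negbTE even_m | /negbFE odd_m].
  by rewrite even_m addr0.
by rewrite odd_m add1n [RHS]big_nat_recr //=; congr (_ + f _); lia.
Qed.

Section Umbral.
Variables (F : numFieldType) (a : F).
Implicit Types p q : {poly F}.

Lemma coshD_Xn m :
  coshD F 'X^m = \sum_(0 <= k < (m./2).+1) 'C(m, 2 * k)%:R *: 'X^(m - 2 * k).
Proof.
rewrite -(big_ord_even (fun i => 'C(m, i)%:R *: 'X^(m - i))).
rewrite /coshD !comp_Xn_poly exprDn exprBn -big_split scaler_sumr.
apply: eq_bigr => i _ /=; rewrite !expr1n !mulr1 -signr_odd; case: (odd i).
  by rewrite expr1 mulN1r mulNrn subrr scaler0.
rewrite expr0 mul1r -mulr2n -!scaler_nat !scalerA mulVf ?mul1r ?scale1r //.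
by rewrite pnatr_eq0.
Qed.

(* Otherwise [rewrite linearZ] unfolds them to their outer scaling by 1/2. *)
Opaque coshD sinhD.

(* The umbral functional 'X^n |-> E_{n,a}. *)
Definition eulerForm p := \sum_(i < size p) p`_i * E a i.

Lemma eulerForm_wide N p : (size p <= N)%N -> eulerForm p = \sum_(i < N) p`_i * E a i.
Proof.
move=> lepN; rewrite /eulerForm (big_ord_widen _ (fun i => p`_i * E a i) lepN) big_mkcond.
by apply: eq_bigr => i _; case: ltnP => // ?; rewrite nth_default ?mul0r.
Qed.

Lemma eulerForm_is_linear : linear_for *%R eulerForm.
Proof.
move=> c p q; pose N := maxn (size p) (size q).
have leN : (size (c *: p + q)%R <= N)%N.
  apply: leq_trans (size_polyD _ _) _; rewrite geq_max leq_maxr andbT.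
  exact: leq_trans (size_scale_leq _ _) (leq_maxl _ _).
rewrite !(eulerForm_wide N) ?leq_maxl ?leq_maxr // mulr_sumr -big_split.
by apply: eq_bigr => i _; rewrite coefD coefZ mulrDl mulrA.
Qed.

HB.instance Definition _ :=
  GRing.isLinear.Build F {poly F} F *%R eulerForm eulerForm_is_linear.

Lemma eulerForm_Xn m : eulerForm 'X^m = E a m.
Proof.
rewrite /eulerForm size_polyXn big_ord_recr /= coefXn eqxx mul1r big1 ?add0r // => i _.
by rewrite coefXn ltn_eqF ?mul0r.
Qed.

(** Dual form of the generating function identity. On ['X^m] with m > 0 it is the recurrence: the k
    = 0 term of [coshD] cancels -a E_{m,a}, and what remains is E_{m,a} + a S = 0. *)
Lemma eulerForm_eval p : eulerForm ((1 - a) *: p + a *: coshD F p) = p.[0].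
Proof.
have EXn m : eulerForm ((1 - a) *: 'X^m + a *: coshD F 'X^m) = (m == 0%N)%:R.
  rewrite coshD_Xn linearD !linearZ /= eulerForm_Xn linear_sum big_ltn //=.
  rewrite muln0 bin0 scale1r subn0 eulerForm_Xn.
  under eq_bigr do rewrite linearZ /= eulerForm_Xn.
  case: m => [|m]; first by rewrite big_geq // addr0 E_0 /=; ring.
  set S := (X in a * (_ + X)); have ES : E a m.+1 = - a * S by exact: E_rec.
  transitivity (E a m.+1 + a * S); first by rewrite /=; ring.
  by rewrite ES mulNr addNr.
have cXn c m : eulerForm ((1 - a) *: (c *: 'X^m) + a *: coshD F (c *: 'X^m)) = c * (m == 0%N)%:R.
  rewrite -EXn -[RHS]linearZ /= scalerDr [coshD F (_ *: _)]linearZ /= !scalerA.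
  by rewrite ![c * _]mulrC.
rewrite -[in LHS](coefK p) poly_def horner_coef0 !(linear_sum, scaler_sumr).
rewrite -big_split linear_sum /=.
under eq_bigr do rewrite cXn.
have [-> | p_neq0] := eqVneq p 0; first by rewrite size_poly0 big_ord0 coef0.
have szp : (0 < size p)%N by rewrite size_poly_gt0.
rewrite (bigD1 (Ordinal szp)) //= big1 => [|i i_neq0]; first by rewrite mulr1 addr0.
by rewrite (negPf i_neq0 : (i == 0 :> nat) = false) mulr0.
Qed.

Hypothesis a2_neq0 : 2 * a - 1 != 0.
Let q := - a ^+ 2 / (2 * a - 1).

Definition eulerInv p := (2 * a - 1)^-1 * (a * (coshD F p).[0] + (a - 1) * p.[0]).

(* (a coshD + (a - 1)) / (2a - 1) inverts 1 - a + a coshD up to the factor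
   1 - q sinhD^2, because coshD^2 - sinhD^2 = 1. *)
Lemma eulerForm_step p : eulerForm p = eulerInv p + q * eulerForm (sinhD F (sinhD F p)).
Proof.
pose r := (2 * a - 1)^-1 *: (a *: coshD F p + (a - 1) *: p).
have -> : eulerInv p = r.[0] by rewrite /eulerInv /r !hornerE.
suff rK : (1 - a) *: r + a *: coshD F r = p - q *: sinhD F (sinhD F p).
  by rewrite -(eulerForm_eval r) rK linearB linearZ /= subrK.
have coshDr : coshD F r = (2 * a - 1)^-1 *: (a *: (p + sinhD F (sinhD F p)) + (a - 1) *: coshD F p).
  by rewrite /r [LHS]linearZ /= [coshD F (_ + _)]linearD /= [coshD F (_ *: coshD F p)]linearZ
     [coshD F (_ *: p)]linearZ /= coshD_coshD.
rewrite coshDr /r -[X in _ = X - _]scale1r -scaleNr.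
rewrite [X in _ = X *: _ + _](_ : _ =
  (1 - a) * (2 * a - 1)^-1 * (a - 1) + a * (2 * a - 1)^-1 * a); last by field.
rewrite (_ : - q = a * (2 * a - 1)^-1 * a); last by rewrite /q; field.
by rewrite -!mul_polyC !(polyCM, polyCB, polyCN, polyCD, polyC1); ring.
Qed.

(** Iterating [eulerForm_step] K times leaves a remainder in [sinhD]^(2K), which kills ['X^(2 * n)]
    at K = n + 1. *)
Lemma E_even_sum n :
  E a (2 * n) = \sum_(k < n.+1) q ^+ k * eulerInv (iter (2 * k) (sinhD F) 'X^(2 * n)).
Proof.
have step K : E a (2 * n) = \sum_(k < K) q ^+ k * eulerInv (iter (2 * k) (sinhD F) 'X^(2 * n))
    + q ^+ K * eulerForm (iter (2 * K) (sinhD F) 'X^(2 * n)).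
  elim: K => [|K IHK]; first by rewrite big_ord0 add0r mul1r eulerForm_Xn.
  rewrite IHK big_ord_recr -addrA eulerForm_step exprSr.
  rewrite (_ : (2 * K.+1)%N = (2 * K).+2) /=; last lia.
  by ring.
by rewrite (step n.+1) iter_sinhD_Xn ?linear0 ?mulr0 ?addr0 //; lia.
Qed.
End Umbral.

(** * Moments at 0 and their triangular recurrence *)

(* The common shape of the moment recurrences: for c k = (2k)^2 this is
   (sinhD^(2k) 'X^(2n))(0), and for c k = (2k+1)^2 - 1 it is
   (coshD sinhD^(2k) ('X^2 - 1)^n)(0), the Y(n, k) of the header. *)
Fixpoint triRec (c : nat -> nat) (n k : nat) : nat :=
  if n is m.+1 then
    (c k * triRec c m k + (if k is l.+1 then k.*2 * k.*2.-1 * triRec c m l else 0))%N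
  else (k == 0%N).

Lemma triRecS c n k : triRec c n.+1 k.+1 =
  (c k.+1 * triRec c n k.+1 + k.*2.+2 * k.*2.+1 * triRec c n k)%N.
Proof. by []. Qed.

Lemma triRec_small c n k : (n < k)%N -> triRec c n k = 0%N.
Proof.
elim: n k => [|n IHn] [|k] //= ltnk.
by rewrite !IHn ?muln0 // ltnW.
Qed.

(** Going from (0, 0) to (n, k), the k steps that raise k contribute the factors of (2k)!, and each
    of the other n - k steps contributes some c i, a multiple of e. *)
Lemma dvdn_triRec c e n k : (forall i, e %| c i)%N ->
  (k.*2`! * e ^ (n - k) %| triRec c n k)%N.
Proof.
move=> dvd_c; elim: n k => [|n IHn] [|k] //=.
  have := IHn 0%N; rewrite !subn0 addn0 expnS !mul1n => IH.
  exact: dvdn_mul.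
apply: dvdn_add; last first.
  rewrite subSS (_ : _`! = k.+1.*2 * k.+1.*2.-1 * k.*2`!)%N; last by rewrite doubleS !factS mulnA.
  by rewrite -mulnA dvdn_mul.
have [ltnk | lekn] := ltnP n k.+1; first by rewrite triRec_small ?muln0.
by rewrite (subSn lekn) expnS mulnCA dvdn_mul.
Qed.

Section Moments.
Variable F : numFieldType.
Implicit Types f : {poly F}.

Definition sinhMoment m f := (iter m (sinhD F) f).[0].
Definition coshMoment m f := (coshD F (iter m (sinhD F) f)).[0].

Lemma iter_sinhD_is_linear m : linear (iter m (sinhD F)).
Proof. by elim: m => // m IHm c f g; rewrite !iterS IHm linearP. Qed.

Lemma sinhMoment_is_linear m : linear_for *%R (sinhMoment m).
Proof. by move=> c f g; rewrite /sinhMoment iter_sinhD_is_linear hornerD hornerZ. Qed.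

Lemma coshMoment_is_linear m : linear_for *%R (coshMoment m).
Proof.
by move=> c f g; rewrite /coshMoment iter_sinhD_is_linear linearP hornerD hornerZ.
Qed.

HB.instance Definition _ m :=
  GRing.isLinear.Build F {poly F} F *%R (sinhMoment m) (sinhMoment_is_linear m).
HB.instance Definition _ m :=
  GRing.isLinear.Build F {poly F} F *%R (coshMoment m) (coshMoment_is_linear m).

Lemma sinhMoment_mulX m f : sinhMoment m ('X * f) = m%:R * coshMoment m.-1 f.
Proof.
rewrite /sinhMoment iter_sinhD_mulX hornerD hornerM hornerX hornerMn.
by rewrite mul0r add0r mulr_natl.
Qed.

Lemma coshMoment_mulX m f :
  coshMoment m ('X * f) = m.+1%:R * sinhMoment m.+1 f + m%:R * sinhMoment m.-1 f.
Proof.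
rewrite /coshMoment iter_sinhD_mulX [coshD F _]linearD linearMn /=.
rewrite coshD_mulX coshD_coshD !(hornerD, hornerM, hornerX, hornerMn) mul0r add0r.
rewrite -mulr_natl; case: m => [|m]; rewrite /sinhMoment /=; ring.
Qed.

Lemma sinhMoment_mulX2 m f : sinhMoment m.+2 ('X * ('X * f)) =
  m.+2%:R ^+ 2 * sinhMoment m.+2 f + (m.+2 * m.+1)%:R * sinhMoment m f.
Proof. by rewrite sinhMoment_mulX coshMoment_mulX /= natrM; ring. Qed.

(** For m < 2 the truncated predecessors do no harm, since m (m - 1) vanishes. *)
Lemma coshMoment_mulX2 m f : coshMoment m ('X * ('X * f)) =
  m.+1%:R ^+ 2 * coshMoment m f + (m * m.-1)%:R * coshMoment m.-2 f.
Proof. by rewrite coshMoment_mulX !sinhMoment_mulX natrM; ring. Qed.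

Lemma sinhMoment_triRec n k :
  sinhMoment k.*2 'X^(2 * n) = (triRec (fun i => i.*2 ^ 2)%N n k)%:R.
Proof.
elim: n k => [|n IHn] [|k].
- by rewrite muln0 expr0 /sinhMoment hornerE.
- by rewrite muln0 /sinhMoment iter_sinhD_Xn // hornerE.
- rewrite (_ : (2 * n.+1)%N = (2 * n).+2); last lia.
  by rewrite !exprS sinhMoment_mulX mul0r.
rewrite (_ : (2 * n.+1)%N = (2 * n).+2); last lia.
rewrite !exprS sinhMoment_mulX2 -[k.*2.+2]/(k.+1.*2) !IHn triRecS natrD !natrM !doubleS.
by ring.
Qed.

(** Subtracting 1 from ['X * 'X] replaces the odd multiplier (2k+1)^2 by (2k+1)^2 - 1 = 4k(k+1), a
    multiple of 8. *)
Lemma coshMoment_triRec n k :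
  coshMoment k.*2 (('X * 'X - 1) ^+ n) = (triRec (fun i => 4 * i * i.+1)%N n k)%:R.
Proof.
elim: n k => [|n IHn] k.
  have cosh1 : coshD F 'X^0 = 'X^0 by rewrite coshD_Xn big_nat1 bin0 scale1r.
  rewrite (_ : _ ^+ 0 = 'X^0) // /coshMoment coshD_iter_sinhD cosh1.
  by case: k => [|k]; [rewrite /= expr0 | rewrite iter_sinhD_Xn //]; rewrite hornerE.
rewrite exprS mulrBl mul1r -mulrA linearB /= coshMoment_mulX2 !IHn.
case: k => [|k]; first by rewrite /= !(muln0, mul0n, addn0) double0; ring.
by rewrite doubleS !succnK IHn -mul2n; ring.
Qed.

Lemma coshMoment_Xn n k : coshMoment k.*2 'X^(2 * n) =
  (\sum_(j < n.+1) 'C(n, j) * triRec (fun i => 4 * i * i.+1) j k)%N%:R.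
Proof.
rewrite exprM -[X in X ^+ n](subrK 1) addrC exprDn.
rewrite linear_sum natr_sum; apply: eq_bigr => i _ /=.
by rewrite expr1n mul1r linearMn natrM -coshMoment_triRec mulr_natl.
Qed.
End Moments.

(** * 2-adic bounds for the moments *)

Lemma logn_bin_lower p n j : (0 < j <= n)%N -> (logn p n <= logn p j + logn p 'C(n, j))%N.
Proof.
case: n j => [|n] [|j] // /andP[_ lejn].
rewrite -lognM ?bin_gt0 // -mul_bin_diag lognM ?leq_addr // bin_gt0.
exact: lejn.
Qed.

(** For j >= 8, 2^(ord_2 j) <= j < 2^(j-4); the values 5, 6, 7 are checked directly. *)
Lemma logn2_le j : (4 < j)%N -> (logn 2 j + 5 <= j)%N.
Proof.
move=> lt4j; have [lt7j | lej7] := ltnP 7 j; last first.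
  by case: j lt4j lej7 => [|[|[|[|[|[|[|[|j]]]]]]]].
have ltj : (j < 2 ^ (j - 4))%N.
  rewrite -(subnK lt7j); elim: (j - 8)%N => // i; rewrite addSn subSn ?expnS; lia.
have := dvdn_leq (ltn_trans (isT : 0 < 4)%N lt4j) (pfactor_dvdnn 2 j).
by move/leq_ltn_trans/(_ ltj); rewrite ltn_exp2l //; lia.
Qed.

(** Equality holds at 8!, and each further step brings an even factor 2k + 2. *)
Lemma logn2_fact_double k : (3 < k)%N -> (k + 3 <= logn 2 (k.*2)`!)%N.
Proof.
move=> lt3k; rewrite -(subnK lt3k); elim: (k - 4)%N => [|i IHi].
  by rewrite !factS !lognM.
rewrite addSn doubleS !factS !lognM ?muln_gt0 ?fact_gt0 //.
have -> : logn 2 (i + 4).*2.+2 = (logn 2 (i + 5)).+1.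
  by rewrite (_ : (i + 4).*2.+2 = 2 * (i + 5))%N ?lognM //; lia.
lia.
Qed.

(** For 0 < k <= j <= n the valuation is at least ord_2 n - ord_2 j + ord_2 (2k)! + 3(j-k). As ord_2
    j <= j - 5, it is enough that the last two terms reach j + 3. Otherwise the product is 0. *)
Lemma dvdn_bin_triRec n j k : (4 < j)%N ->
  (2 ^ (logn 2 n + 8) %| 'C(n, j) * triRec (fun i => 4 * i * i.+1) j k)%N.
Proof.
move=> lt4j; have [ltnj | lejn] := ltnP n j; first by rewrite bin_small.
case: k => [|k].
  by case: j lt4j {lejn} => // j _ /=; rewrite !mul0n muln0.
have [ltjk | lekj] := ltnP j k.+1; first by rewrite triRec_small ?muln0.
have dvd8 i : (8 %| 4 * i * i.+1)%N.
  by rewrite -mulnA (@dvdn_pmul2l 4 2) // dvdn2 oddM /= andbN.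
apply: dvdn_trans (dvdn_mul (dvdnn _) (@dvdn_triRec _ 8 j k.+1 dvd8)).
have bin_pos : (0 < 'C(n, j))%N by rewrite bin_gt0.
rewrite pfactor_dvdn ?muln_gt0 ?bin_pos ?fact_gt0 ?expn_gt0 //.
rewrite lognM ?muln_gt0 ?fact_gt0 ?expn_gt0 // lognM ?fact_gt0 ?expn_gt0 // lognX.
have := logn_bin_lower 2 n j; rewrite lejn (ltn_trans _ lt4j) // => /(_ isT).
have := logn2_le j lt4j; have -> : logn 2 8 = 3%N by [].
have [ltk | lek] := leqP 4 k.+1; last first.
  case: k lekj lek => [|[|[|k]]] // lekj _.
  - have -> : logn 2 1.*2`! = 1%N by []. lia.
  - have -> : logn 2 2.*2`! = 3%N by []. lia.
  - have -> : logn 2 3.*2`! = 4%N by rewrite !factS !lognM. lia.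
(* On the diagonal no power of 8 is left; the factor 2j of (2j)! makes up for ord_2 j. *)
have [eqkj | neq] := eqVneq k.+1 j; last by have := logn2_fact_double k.+1 ltk; lia.
have lt3k : (3 < k)%N by lia.
rewrite -eqkj subnn doubleS !factS !lognM ?muln_gt0 ?fact_gt0 //.
have -> : logn 2 k.*2.+2 = (logn 2 k.+1).+1.
  by rewrite (_ : k.*2.+2 = 2 * k.+1)%N ?lognM //; lia.
by have := logn2_fact_double k lt3k; lia.
Qed.

(** Here ord_2 (2k)! + 2(n-k) >= n + 3 >= ord_2 n + 8 for 0 < k <= n. *)
Lemma dvdn_triRec_even n k : (4 < n)%N ->
  (2 ^ (logn 2 n + 8) %| triRec (fun i => i.*2 ^ 2)%N n k)%N.
Proof.
move=> lt4n; case: k => [|k]; first by case: n lt4n => //= n _; rewrite !mul0n.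
have [ltnk | lekn] := ltnP n k.+1; first by rewrite triRec_small.
have dvd4 i : (4 %| i.*2 ^ 2)%N by rewrite -mul2n expnMn dvdn_mulr.
apply: dvdn_trans (@dvdn_triRec _ 4 n k.+1 dvd4).
rewrite pfactor_dvdn ?muln_gt0 ?fact_gt0 ?expn_gt0 //.
rewrite lognM ?fact_gt0 ?expn_gt0 // lognX.
have := logn2_le n lt4n; have -> : logn 2 4 = 2%N by [].
case: k lekn => [|[|[|k]]] lekn.
- have -> : logn 2 1.*2`! = 1%N by []. lia.
- have -> : logn 2 2.*2`! = 3%N by []. lia.
- have -> : logn 2 3.*2`! = 4%N by rewrite !factS !lognM. lia.
by have := logn2_fact_double k.+4 isT; lia.
Qed.

(** * The ring of p-integral rationals *)

Lemma p_integral_frac p (m d : int) : coprime p `|d| -> p_integral p (m%:Q / d%:Q).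
Proof.
move=> co_pd; rewrite /p_integral; have [-> | d_neq0] := eqVneq d 0.
  by rewrite invr0 mulr0 coprimen1.
apply: coprime_dvdr co_pd.
have := fracqE (m, d) => /= <-; rewrite den_fracq /= d_neq0 absz_nat.
exact: dvdn_div (dvdn_gcdr _ _).
Qed.

Lemma p_integralP p (x : rat) : reflect
  (exists m d : int, [/\ d != 0, coprime p `|d| & x = m%:Q / d%:Q]) (p_integral p x).
Proof.
apply: (iffP idP) => [px | [m [d [_ co_pd ->]]]]; last exact: p_integral_frac.
by exists (numq x), (denq x); rewrite divq_num_den denq_neq0.
Qed.

Lemma p_integral_subring p : subring_closed (p_integral p).
Proof.
split=> [|x y /p_integralP[m [d [d0 cd ->]]] /p_integralP[m' [d' [d'0 cd' ->]]]
         |x y /p_integralP[m [d [d0 cd ->]]] /p_integralP[m' [d' [d'0 cd' ->]]]];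
  apply/p_integralP.
- by exists 1, 1; rewrite coprimen1 divr1.
- exists (m * d' - m' * d), (d * d').
  rewrite mulf_neq0 // abszM coprimeMr cd cd'; split=> //.
  have d0Q : d%:Q != 0 by rewrite intr_eq0.
  have d'0Q : d'%:Q != 0 by rewrite intr_eq0.
  by rewrite rmorphB !rmorphM /=; field; rewrite d0Q d'0Q.
- exists (m * m'), (d * d').
  rewrite mulf_neq0 // abszM coprimeMr cd cd'; split=> //.
  by rewrite !rmorphM /= mulf_div.
Qed.

HB.instance Definition _ p :=
  GRing.isSubringClosed.Build rat (p_integral p) (p_integral_subring p).

(** * The surviving terms modulo 256 *)

(* Up to the denominator 3 (2a - 1)^5 and the factor n, the difference between
   the surviving terms and the polynomial of the theorem is a polynomial whose
   coefficients are all multiples of 16: it is 16 residue16 + 256 quotient256,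
   the coefficients of residue16 being reduced to [0, 16). *)
Definition residue16 {R : comNzRingType} (n a : R) : R :=
    (8 * a + 4 * a ^+ 2 + 8 * a ^+ 4 + 12 * a ^+ 5 + 4 * a ^+ 6 + 10 * a ^+ 7
     + 8 * a ^+ 8 + 10 * a ^+ 9)
  + (8 * a + 8 * a ^+ 3 + 6 * a ^+ 4 + 3 * a ^+ 5 + 6 * a ^+ 6 + 12 * a ^+ 7
     + 9 * a ^+ 9 + 8 * a ^+ 10 + 8 * a ^+ 11) * n
  + (8 * a ^+ 3 + 8 * a ^+ 7 + 4 * a ^+ 8 + 10 * a ^+ 9 + 8 * a ^+ 10
     + 8 * a ^+ 11) * n ^+ 2
  + (4 * a ^+ 2 + 10 * a ^+ 4 + 11 * a ^+ 5 + 2 * a ^+ 6 + 10 * a ^+ 7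
     + 12 * a ^+ 8 + 11 * a ^+ 9) * n ^+ 3
  + (14 * a ^+ 3 + 4 * a ^+ 4) * n ^+ 4.

Definition quotient256 {R : comNzRingType} (n a : R) : R :=
    (a - 16 * a ^+ 2 + 65 * a ^+ 3 - 137 * a ^+ 4 + 108 * a ^+ 5 + 79 * a ^+ 6
     - 262 * a ^+ 7 + 256 * a ^+ 8 - 166 * a ^+ 9 + 135 * a ^+ 10
     - 102 * a ^+ 11 + 30 * a ^+ 12)
  + (- 2 * a + 15 * a ^+ 2 - 55 * a ^+ 3 + 84 * a ^+ 4 + 66 * a ^+ 5
     - 443 * a ^+ 6 + 711 * a ^+ 7 - 486 * a ^+ 8 + 6 * a ^+ 9 + 169 * a ^+ 10
     - 68 * a ^+ 11 + 9 * a ^+ 12) * n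
  + (- 4 * a ^+ 3 + 24 * a ^+ 4 - 120 * a ^+ 5 + 310 * a ^+ 6 - 455 * a ^+ 7
     + 350 * a ^+ 8 - 85 * a ^+ 9 - 68 * a ^+ 10 + 67 * a ^+ 11 - 27 * a ^+ 12)
    * n ^+ 2
  + (- a ^+ 2 + 8 * a ^+ 3 - 34 * a ^+ 4 + 79 * a ^+ 5 - 120 * a ^+ 6
     + 128 * a ^+ 7 - 102 * a ^+ 8 + 46 * a ^+ 9 - 6 * a ^+ 10) * n ^+ 3
  + (- 2 * a ^+ 3 + 11 * a ^+ 4 - 45 * a ^+ 5 + 90 * a ^+ 6 - 90 * a ^+ 7
     + 36 * a ^+ 8) * n ^+ 4.

Lemma rmorph_residue16 {R S : comNzRingType} (f : {rmorphism R -> S}) n a :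
  f (residue16 n a) = residue16 (f n) (f a).
Proof. by rewrite /residue16 !(rmorph_nat, rmorphXn, rmorphM, rmorphD). Qed.

Lemma rmorph_quotient256 {R S : comNzRingType} (f : {rmorphism R -> S}) n a :
  f (quotient256 n a) = quotient256 (f n) (f a).
Proof. by rewrite /quotient256 !(rmorph_nat, rmorphXn, rmorphN, rmorphM, rmorphD). Qed.

(** The coefficients are not zero modulo 16; only the values vanish, so all 256 pairs of residues
    are tested. *)
Lemma residue16_Z16 (x y : 'Z_16) : residue16 x y = 0.
Proof.
have /allP check : all (fun i => all (fun j => residue16 (i%:R : 'Z_16) j%:R == 0)
                                 (iota 0 16)) (iota 0 16) by vm_compute.
rewrite -(natr_Zp x) -(natr_Zp y).
have x_in : (x : nat) \in iota 0 16 by rewrite mem_iota ltn_ord.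
have y_in : (y : nat) \in iota 0 16 by rewrite mem_iota ltn_ord.
by apply/eqP; exact: (allP (check _ x_in) _ y_in).
Qed.

Lemma dvdz_residue16 (n a : int) : (16 %| residue16 n a)%Z.
Proof.
have := residue16_Z16 n%:~R a%:~R.
rewrite -(rmorph_residue16 intr); set z := residue16 n a.
rewrite {1}(divz_eq z 16) rmorphD rmorphM /=.
have -> : (16%:~R : 'Z_16) = 0 by apply/eqP; vm_compute.
rewrite mulr0 add0r /dvdz => z_mod; apply/dvdz_mod0P.
have z_ge0 : 0 <= (z %% 16)%Z by rewrite modz_ge0.
have z_lt : (z %% 16)%Z < 16 by rewrite ltz_pmod.
case: (_ %% _)%Z z_mod z_ge0 z_lt => // r /(congr1 val) /=; rewrite val_Zp_nat //= => + _ ltr.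
by rewrite modn_small // => ->.
Qed.

Lemma bin_small_natr (F : numFieldType) n : (3 < n)%N ->
  [/\ 'C(n, 2)%:R = n%:R * (n%:R - 1) / 2 :> F,
      'C(n, 3)%:R = n%:R * (n%:R - 1) * (n%:R - 2) / 6 :> F &
      'C(n, 4)%:R = n%:R * (n%:R - 1) * (n%:R - 2) * (n%:R - 3) / 24 :> F].
Proof.
move=> lt3n.
have binS m : (m < n)%N -> 'C(n, m.+1)%:R = 'C(n, m)%:R * (n%:R - m%:R) / m.+1%:R :> F.
  move=> ltmn; rewrite -natrB; last exact: ltnW.
  apply: (canRL (mulfK _)); first by rewrite pnatr_eq0.
  by rewrite -!natrM mulnC mul_bin_left mulnC.
have C2 : 'C(n, 2)%:R = n%:R * (n%:R - 1) / 2 :> F by rewrite binS ?bin1 //; lia.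
have C3 : 'C(n, 3)%:R = n%:R * (n%:R - 1) * (n%:R - 2) / 6 :> F.
  by rewrite binS ?C2; [field | lia].
by split=> //; rewrite binS ?C3; [field | lia].
Qed.

(** The 3 comes from the denominators 6 and 24 of C3 and C4, the fifth power from a / (2a - 1) times
    q^4. Once 16 divides [residue16], the numerator is n times a multiple of 256. *)
Lemma main_term_identity (F : numFieldType) (n a : F) (q := - a ^+ 2 / (2 * a - 1))
    (C2 := n * (n - 1) / 2) (C3 := n * (n - 1) * (n - 2) / 6)
    (C4 := n * (n - 1) * (n - 2) * (n - 3) / 24) : 2 * a - 1 != 0 ->
  a / (2 * a - 1) *
    (1 + q * (2 * n + 16 * C2 + 128 * C3 + 8 * 128 * C4)
     + q ^+ 2 * (24 * C2 + 768 * C3 + 26 * 768 * C4)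
     + q ^+ 3 * (720 * C3 + 80 * 720 * C4) + q ^+ 4 * (56 * 720 * C4))
  - (a / (2 * a - 1)
     - 96 * a ^+ 3 * n ^+ 5
     + (16 * a ^+ 5 - 32 * a ^+ 4 - 64 * a ^+ 2) * n ^+ 4
     + (72 * a ^+ 7 - 64 * a ^+ 3) * n ^+ 3
     - (24 * a ^+ 7 - 120 * a ^+ 6 + 92 * a ^+ 5 - 56 * a ^+ 3
        + 128 * a) * n ^+ 2
     - (80 * a ^+ 7 - 72 * a ^+ 6 - 20 * a ^+ 5 + 104 * a ^+ 4
        - 6 * a ^+ 3 + 64 * a ^+ 2 - 128 * a) * n)
  = n * (16 * residue16 n a + 16 * 16 * quotient256 n a) / (3 * (2 * a - 1) ^+ 5).
Proof.
by move=> nz; rewrite /q /C2 /C3 /C4 /residue16 /quotient256; field; rewrite nz.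
Qed.

(** * Assembly of the congruence *)

Lemma E_even_moments (F : numFieldType) (a : F) n : 2 * a - 1 != 0 ->
  E a (2 * n) = \sum_(k < n.+1) (- a ^+ 2 / (2 * a - 1)) ^+ k * ((2 * a - 1)^-1 *
    (a * (\sum_(j < n.+1) 'C(n, j) * triRec (fun i => 4 * i * i.+1) j k)%N%:R
     + (a - 1) * (triRec (fun i => i.*2 ^ 2)%N n k)%:R)).
Proof.
move=> nz; rewrite E_even_sum //; apply: eq_bigr => k _.
by rewrite /eulerInv -/(coshMoment F _ _) -/(sinhMoment F _ _) mul2n
   coshMoment_Xn sinhMoment_triRec.
Qed.

(** The quotients of the tails j >= 5 are chosen as one function of k, so that they can be summed
    over k later. *)
Lemma sum_bin_triRec_split n (c := fun i => (4 * i * i.+1)%N) : (4 < n)%N ->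
  exists t : nat -> nat, forall k, (\sum_(j < n.+1) 'C(n, j) * triRec c j k =
    \sum_(j < 5) 'C(n, j) * triRec c j k + 2 ^ (logn 2 n + 8) * t k)%N.
Proof.
move=> lt4n; pose tail k := (\sum_(5 <= j < n.+1) 'C(n, j) * triRec c j k)%N.
exists (fun k => tail k %/ 2 ^ (logn 2 n + 8))%N => k.
have dvd_tail : (2 ^ (logn 2 n + 8) %| tail k)%N.
  by rewrite /tail big_nat; apply: dvdn_sum => j /andP[lt4j _]; apply: dvdn_bin_triRec.
rewrite [(_ ^ _ * _)%N]mulnC divnK // -!(big_mkord xpredT (fun j => 'C(n, j) * triRec c j k)%N).
by rewrite (@big_cat_nat _ _ _ 5) //= ltnW.
Qed.

Lemma sum_ord5 {V : nmodType} (f : nat -> V) :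
  \sum_(i < 5) f i = f 0%N + f 1%N + f 2%N + f 3%N + f 4%N.
Proof. by rewrite !big_ord_recr big_ord0 /= add0r. Qed.

Lemma sum_bin_triRec_values n (c := fun i => (4 * i * i.+1)%N)
    (M := fun k => (\sum_(j < 5) 'C(n, j) * triRec c j k)%N) :
  [/\ M 0 = 1, M 1 = 2 * n + 16 * 'C(n, 2) + 128 * 'C(n, 3) + 8 * 128 * 'C(n, 4),
      M 2 = 24 * 'C(n, 2) + 768 * 'C(n, 3) + 26 * 768 * 'C(n, 4),
      M 3 = 720 * 'C(n, 3) + 80 * 720 * 'C(n, 4) & M 4 = 56 * 720 * 'C(n, 4)]%N.
Proof.
have c00 : triRec c 0 0 = 1%N by [].
have cn0 i : triRec c i.+1 0 = 0%N by rewrite /= !mul0n.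
have c0k k : triRec c 0 k.+1 = 0%N by [].
by split; rewrite /M (sum_ord5 (fun j => 'C(n, j) * triRec c j _)%N)
  ?triRecS ?(c00, cn0, c0k) ?(bin0, bin1) /c; lia.
Qed.

Theorem theorem3p1 (a : int) (n : nat) (ha : a != 0) (hn : (5 <= n)%N) :
  congr_pow 2 (logn 2 n + 8)
    (E a%:Q (2 * n))
    (a%:Q / (2 * a%:Q - 1)
     - 96 * a%:Q ^+ 3 * n%:R ^+ 5
     + (16 * a%:Q ^+ 5 - 32 * a%:Q ^+ 4 - 64 * a%:Q ^+ 2) * n%:R ^+ 4
     + (72 * a%:Q ^+ 7 - 64 * a%:Q ^+ 3) * n%:R ^+ 3
     - (24 * a%:Q ^+ 7 - 120 * a%:Q ^+ 6 + 92 * a%:Q ^+ 5 - 56 * a%:Q ^+ 3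
        + 128 * a%:Q) * n%:R ^+ 2
     - (80 * a%:Q ^+ 7 - 72 * a%:Q ^+ 6 - 20 * a%:Q ^+ 5 + 104 * a%:Q ^+ 4
        - 6 * a%:Q ^+ 3 + 64 * a%:Q ^+ 2 - 128 * a%:Q) * n%:R).
Proof.
set P := (X in congr_pow _ _ _ X); set v := (logn 2 n + 8)%N.
have intZ (m : int) : m%:Q \in p_integral 2 by exact: rpred_int.
have intE : E a%:Q (2 * n) \in p_integral 2.
  by rewrite -(rmorph_E intr); exact: intZ.
(* Integrality of P then follows from P = E - 2^v z. *)
suff [z z_int EP] : exists2 z : rat, z \in p_integral 2 & E a%:Q (2 * n) - P = 2 ^+ v * z.
  have intP : P \in p_integral 2.
    have -> : P = E a%:Q (2 * n) - 2 ^+ v * z by rewrite -EP; ring.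
    by rewrite rpredB // rpredM // rpredX // (intZ 2).
  by split=> //; exists z.
have nz : 2 * a%:Q - 1 != 0.
  rewrite (_ : _ - 1 = (2 * a - 1)%:~R) ?intr_eq0; last by rewrite rmorphB rmorphM.
  by lia.
have int_inv : (2 * a%:Q - 1)^-1 \in p_integral 2.
  rewrite -[_^-1]mul1r (_ : 2 * a%:Q - 1 = (2 * a - 1)%:~R); last by rewrite rmorphB rmorphM.
  apply: (@p_integral_frac 2 1); rewrite coprime2n; lia.
have int3 : 3^-1 \in p_integral 2 by rewrite -[_^-1]mul1r; exact: (@p_integral_frac 2 1 3).
set q := - a%:Q ^+ 2 / (2 * a%:Q - 1).
have intq : q \in p_integral 2 by rewrite rpredM // rpredN rpredX // intZ.
pose c := fun i => (4 * i * i.+1)%N; pose d i := (i.*2 ^ 2)%N.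
have [t Et] := sum_bin_triRec_split n hn.
pose M k : rat := (\sum_(j < 5) 'C(n, j) * triRec c j k)%N%:R.
pose s k := (triRec d n k %/ 2 ^ v)%N.
have Es k : triRec d n k = (2 ^ v * s k)%N by rewrite mulnC divnK // dvdn_triRec_even.
(* Only the cosh part with j <= 4 remains; its tails [t] and the whole sinh part [s] carry the
   factor 2^v. *)
have EE : E a%:Q (2 * n) = \sum_(k < n.+1) q ^+ k * ((2 * a%:Q - 1)^-1 * (a%:Q * M k)) +
    2 ^+ v * \sum_(k < n.+1) q ^+ k * ((2 * a%:Q - 1)^-1 *
      (a%:Q * (t k)%:R + (a%:Q - 1) * (s k)%:R)).
  rewrite E_even_moments // mulr_sumr -big_split; apply: eq_bigr => k _ /=.
  by rewrite Et Es natrD !natrM natrX -/(M k) -/q; ring.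
have sumM : \sum_(k < n.+1) q ^+ k * ((2 * a%:Q - 1)^-1 * (a%:Q * M k)) =
    a%:Q / (2 * a%:Q - 1) * (\sum_(k < 5) q ^+ k * M k).
  rewrite mulr_sumr -(big_mkord xpredT (fun k => q ^+ k * ((2 * a%:Q - 1)^-1 * (a%:Q * M k)))).
  (* Terms with k >= 5 vanish because j <= 4 < k. *)
  rewrite (big_cat_nat _ (n := 5)) //=; last exact: ltnW.
  rewrite [X in _ + X]big_nat [X in _ + X]big1 => [|k /andP[lt4k _]].
    by rewrite addr0 big_mkord; apply: eq_bigr => k _; ring.
  rewrite (_ : M k = 0) ?mulr0 //; rewrite /M big1 // => j _.
  by rewrite triRec_small ?muln0 // (leq_trans (ltn_ord j)).
have valM : \sum_(k < 5) q ^+ k * M k =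
  1 + q * (2 * n%:R + 16 * 'C(n, 2)%:R + 128 * 'C(n, 3)%:R + 8 * 128 * 'C(n, 4)%:R)
   + q ^+ 2 * (24 * 'C(n, 2)%:R + 768 * 'C(n, 3)%:R + 26 * 768 * 'C(n, 4)%:R)
   + q ^+ 3 * (720 * 'C(n, 3)%:R + 80 * 720 * 'C(n, 4)%:R) + q ^+ 4 * (56 * 720 * 'C(n, 4)%:R).
  have [M0 M1 M2 M3 M4] := sum_bin_triRec_values n.
  by rewrite (sum_ord5 (fun k => q ^+ k * M k)) /M M0 M1 M2 M3 M4; ring.
have [C2 C3 C4] := bin_small_natr rat n (ltnW hn).
have [r Er] : exists r : int, residue16 n%:Z a = 16 * r.
  by have /dvdzP[r ->] := dvdz_residue16 n a; exists r; rewrite mulrC.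
have ErQ : residue16 n%:R a%:Q = 16 * r%:Q.
  have := congr1 (intr : int -> rat) Er.
  by rewrite (rmorph_residue16 intr) rmorphM.
(* The factor n of the main difference supplies ord_2 n in the exponent v; the 8 comes from 256. *)
have [m _ En] := pfactor_coprime (isT : prime 2) (ltn_trans (isT : 0 < 4)%N hn).
have nQ : n%:R = m%:R * 2 ^+ logn 2 n :> rat by rewrite -natrX -natrM -En.
(* The sum collects the discarded parts; the other term is n (r + [quotient256]) / (3 (2a - 1)^5)
   with 2^(ord_2 n) removed from n. *)
exists (\sum_(k < n.+1) q ^+ k * ((2 * a%:Q - 1)^-1 *
      (a%:Q * (t k)%:R + (a%:Q - 1) * (s k)%:R)) +
   m%:R * (r%:Q + quotient256 n%:R a%:Q) * (3^-1 * (2 * a%:Q - 1)^-1 ^+ 5)).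
  rewrite rpredD ?rpred_sum // => [k _|].
    rewrite rpredM ?rpredX // rpredM // rpredD // rpredM ?(intZ (t k)) ?(intZ (s k)) //.
    by rewrite rpredB // ?(intZ 1).
  rewrite !rpredM ?rpredX ?(intZ m) // rpredD //.
  by have <- := rmorph_quotient256 (intr : {rmorphism int -> rat}) n%:Z a; exact: intZ.
set B := \sum_(k < n.+1) _.
set z := _ * (_ * _).
suff main : a%:Q / (2 * a%:Q - 1) * (\sum_(k < 5) q ^+ k * M k) - P = 2 ^+ v * z.
  by rewrite EE sumM -/B mulrDr -main; ring.
rewrite valM C2 C3 C4 main_term_identity // ErQ /z /v exprD nQ.
by field.
Qed.
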